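(* Let $1\le M\le N$ and let $\beta\ge\lambda_1\ge\lambda_2\ge\cdots\ge\lambda_M\ge\alpha$ be ordered real random variables whose joint p.d.f. on the ordered region $\beta\ge x_1\ge\cdots\ge x_M\ge\alpha$ is $$f_{\boldsymbol\lambda}(\boldsymbol x)=K\,\det\boldsymbol\Phi(\boldsymbol x)\,\det\boldsymbol\Psi(\boldsymbol x)\prod_{i=1}^{M}\xi(x_i),$$ where $K$ is the normalizing constant, $\xi$ is a function, $\boldsymbol\Phi(\boldsymbol x)\in\mathbb C^{M\times M}$ has entries $\Phi_i(x_j)$, and $\boldsymbol\Psi(\boldsymbol x)\in\mathbb C^{N\times N}$ has entries $\Psi_i(x_j)$ for $j\le M$ and constants $\bar\Psi_{i,j}$ for $M<j\le N$. Then for $1\le\ell<s\le M$ the joint p.d.f. of $\lambda_\ell$ and $\lambda_s$ is, for $\beta\ge x_\ell\ge x_s\ge\alpha$, $$f_{\lambda_\ell,\lambda_s}(x_\ell,x_s)=c(\ell,s)\,K\,\mathcal T(\boldsymbol A),\qquad c(\ell,s)=\frac{1}{(\ell-1)!\,(s-\ell-1)!\,(M-s)!},$$ where the $N\times N\times N$ tensor $\boldsymbol A$ has elements $$a_{i,j,k}=\begin{cases}\displaystyle\int_{x_\ell}^{\beta}\varsigma_i(x)\Psi_j(x)\,dx & k<\ell\le M\\ \varsigma_i(x_\ell)\Psi_j(x_\ell)& k=\ell\le M\\ \displaystyle\int_{x_s}^{x_\ell}\varsigma_i(x)\Psi_j(x)\,dx & \ell<k<s\le M\\ \varsigma_i(x_s)\Psi_j(x_s)&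 k=s\le M\\ \displaystyle\int_\alpha^{x_s}\varsigma_i(x)\Psi_j(x)\,dx & s<k\le M\\ 0& k>M,\ i<k\\ \bar\Psi_{j,k}& k>M,\ i\ge k,\end{cases}\qquad \varsigma_i(x)=\begin{cases}\Phi_i(x)\xi(x)& i\le M\\ \xi(x)& i>M.\end{cases}$$
   Context: For a rank-3 tensor $\boldsymbol A=\{a_{i,j,k}\}_{i,j,k=1,\dots,N}$ the pseudo-determinant is $\mathcal T(\boldsymbol A)=\sum_{\boldsymbol\mu}\operatorname{sgn}(\boldsymbol\mu)\sum_{\boldsymbol\alpha}\operatorname{sgn}(\boldsymbol\alpha)\prod_{k=1}^N a_{\mu_k,\alpha_k,k}$, where both sums run over all permutations of $\{1,\dots,N\}$. The endpoints $\alpha<\beta$ may be infinite. The scalar functions $\Phi_i$ ($1\le i\le M$), $\Psi_i$ ($1\le i\le N$), $\xi$ and the constants $\bar\Psi_{i,j}$ are arbitrary, subject to the function $f_{\boldsymbol\lambda}(\boldsymbol x)=K\,\det\boldsymbol\Phi(\boldsymbol x)\,\det\boldsymbol\Psi(\boldsymbol x)\prod_{i=1}^{M}\xi(x_i)$ being a p.d.f. on the ordered region $\beta\ge x_1\ge\cdots\ge x_M\ge\alpha$ and to the integrals appearing being well defined (absolutely convergent). *)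

(* Defs.v *)
From HB Require Import structures.
From mathcomp Require Import all_boot all_order all_algebra all_fingroup.
From mathcomp Require Import all_classical all_reals all_analysis.
From mathcomp Require Import complex.

Set Implicit Arguments.
Unset Strict Implicit.
Unset Printing Implicit Defensive.

Import Order.TTheory GRing.Theory Num.Theory.
Import numFieldNormedType.Exports.

Local Open Scope classical_set_scope.
Local Open Scope ring_scope.

(* The n-dimensional Lebesgue measure, built by recursion on n as the image of
   lebesgue_measure \x lebesgue_tuple n under (x, t) |-> x :: t; it is
   characterized by its values on boxes, see lebesgue_tuple_box. *)
Section lebesgue_tuple.
Variable R : realType.

Definition tuple_consp n (p : R * n.-tuple R) : n.+1.-tuple R :=
  [tuple of p.1 :: p.2].

Lemma measurable_tuple_consp n : measurable_fun setT (@tuple_consp n).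
Proof.
apply: measurable_cons.
- exact: measurable_fst.
- exact: measurable_snd.
Qed.

Section step.
Variables (n : nat) (mu : {sigma_finite_measure set (n.-tuple R) -> \bar R}).

Definition lebesgue_tupleS : set (n.+1.-tuple R) -> \bar R :=
  pushforward (@lebesgue_measure R \x mu)%E (@tuple_consp n).

Let lebesgue_tupleS0 : lebesgue_tupleS set0 = 0%E.
Proof. by rewrite /lebesgue_tupleS /pushforward preimage_set0 measure0. Qed.

Let lebesgue_tupleS_ge0 A : (0 <= lebesgue_tupleS A)%E.
Proof. rewrite /lebesgue_tupleS /pushforward; exact: measure_ge0. Qed.

Let lebesgue_tupleS_sigma_additive : semi_sigma_additive lebesgue_tupleS.
Proof.
have mC := @measurable_tuple_consp n.
move=> F mF tF mUF; rewrite /lebesgue_tupleS /pushforward preimage_bigcup.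
apply: measure_semi_sigma_additive.
- by move=> k; rewrite -[X in measurable X]setTI; exact: mC.
- apply/trivIsetP => /= i j _ _ ij; rewrite -preimage_setI.
  by move/trivIsetP : tF => /(_ _ _ _ _ ij) ->//; rewrite preimage_set0.
- by rewrite -preimage_bigcup -[X in measurable X]setTI; exact: mC.
Qed.

HB.instance Definition _ := isMeasure.Build _ _ _ lebesgue_tupleS
  lebesgue_tupleS0 lebesgue_tupleS_ge0 lebesgue_tupleS_sigma_additive.

Let lebesgue_tupleS_sigma_finite : sigma_finite setT lebesgue_tupleS.
Proof.
have /sigma_finiteP[F [FT ndF Foo]] := sigma_finiteT (@lebesgue_measure R).
have /sigma_finiteP[G [GT ndG Goo]] := sigma_finiteT mu.
pose H k : set (n.+1.-tuple R) :=
  [set t | F k (thead t) /\ G k [tuple of behead t]].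
exists H.
  apply/seteqP; split=> // t _.
  have : (\bigcup_k F k) (thead t) by rewrite -FT.
  have : (\bigcup_k G k) [tuple of behead t] by rewrite -GT.
  move=> [j _ Gj] [i _ Fi]; exists (maxn i j) => //; split.
    by move: Fi; exact/subsetPset/ndF/leq_maxl.
  by move: Gj; exact/subsetPset/ndG/leq_maxr.
move=> k; have [mF Fk] := Foo k; have [mG Gk] := Goo k; split.
  apply: measurableI.
    by rewrite -[X in measurable X]setTI; exact: measurable_tnth.
  by rewrite -[X in measurable X]setTI; exact: measurable_behead.
rewrite /lebesgue_tupleS /pushforward.
rewrite (_ : _ @^-1` _ = F k `*` G k); last first.
  apply/seteqP; split => -[x t] /=; rewrite /H /= theadE.
    by move=> [? h]; split => //=; congr (G k _) : h; exact: val_inj.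
  by move=> [? h]; split => //=; congr (G k _) : h; exact: val_inj.
rewrite product_measure1E//.
by rewrite lte_mul_pinfty// ge0_fin_numE.
Qed.

HB.instance Definition _ := @Measure_isSigmaFinite.Build _ _ _
  lebesgue_tupleS
  lebesgue_tupleS_sigma_finite.

Definition lebesgue_tuple_step :
  {sigma_finite_measure set (n.+1.-tuple R) -> \bar R} := lebesgue_tupleS.

End step.

Fixpoint lebesgue_tuple n : {sigma_finite_measure set (n.-tuple R) -> \bar R} :=
  match n with
  | 0 => @dirac _ _ [tuple] R
  | n'.+1 => lebesgue_tuple_step (lebesgue_tuple n')
  end.

Lemma lebesgue_tuple_box n (B : 'I_n -> set R) :
  (forall i, measurable (B i)) ->
  lebesgue_tuple n [set x | forall i, B i (tnth x i)] =
  (\prod_(i < n) lebesgue_measure (B i))%E.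
Proof.
elim: n B => [|n IH] B mB.
  by rewrite big_ord0 /= /dirac /= indicE mem_set//; case.
have E : @tuple_consp n @^-1` [set x | forall i, B i (tnth x i)] =
    B ord0 `*` [set x | forall i, B (lift ord0 i) (tnth x i)].
  apply/seteqP; split => -[x t] /=.
    move=> h; split; first by have := h ord0; rewrite tnth0.
    by move=> i; have := h (lift ord0 i); rewrite tnthS.
  move=> [h0 h] i; case: (unliftP ord0 i) => [j ->|->].
    by rewrite tnthS.
  by rewrite tnth0.
have mB' : measurable [set x : n.-tuple R |
    forall i, B (lift ord0 i) (tnth x i)].
  rewrite (_ : mkset _ = \bigcap_(i in [set: 'I_n])
      (fun x : n.-tuple R => tnth x i) @^-1` B (lift ord0 i)); last first.
    by apply/seteqP; split => x /= + i => [/(_ i)//|]; exact.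
  apply: fin_bigcap_measurable => // i _.
  by rewrite -[X in measurable X]setTI; exact: measurable_tnth.
rewrite big_ord_recl -IH// -product_measure1E//; last exact: mB.
exact: (congr1 (@lebesgue_measure R \x lebesgue_tuple n)%E E).
Qed.

End lebesgue_tuple.

Section complex_integral.
Context d (T : measurableType d) (R : realType).
Variables (mu : {measure set T -> \bar R}) (D : set T).
Implicit Type f : T -> R[i].

Definition cmeasurable f :=
  measurable_fun D (fun x => complex.Re (f x)) /\
  measurable_fun D (fun x => complex.Im (f x)).

Definition cintegrable f :=
  cmeasurable f /\ (\int[mu]_(x in D) (complex.Re `|f x|)%:E < +oo)%E.

Definition cintegral f : R[i] :=
  Complex (Rintegral mu D (fun x => complex.Re (f x)))
          (Rintegral mu D (fun x => complex.Im (f x))).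

End complex_integral.

(* X has p.d.f. f on D with respect to mu (and density 0 outside D).  The
   densities of interest are given by complex-valued formulas; 0 <= f x in R[i]
   says that f x is real and nonnegative. *)
Definition has_pdf_on d (Omega : measurableType d) (R : realType)
    (P : probability Omega R) d' (T : measurableType d')
    (mu : {measure set T -> \bar R}) (X : Omega -> T) (D : set T) (f : T -> R[i]) :=
  [/\ forall x, D x -> 0 <= f x,
      measurable_fun D (fun x => complex.Re (f x)) &
      forall A, measurable A ->
        P (X @^-1` A) = (\int[mu]_(x in A `&` D) (complex.Re (f x))%:E)%E].

Definition pseudo_det (C : comNzRingType) (N : nat)
    (A : 'I_N -> 'I_N -> 'I_N -> C) : C :=
  \sum_(u : 'S_N) (-1) ^+ u *
    \sum_(a : 'S_N) (-1) ^+ a * \prod_(k < N) A (u k) (a k) k.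

(* All indices are 0-based: row, column and tensor indices, as well as the
   positions l < s of the two selected variables, range over 'I_M or 'I_N. *)
Section ordered_density.
Variables (R : realType) (alpha beta : \bar R) (M N : nat).
Variables (Phi : 'I_M -> R -> R[i]) (Psi : 'I_N -> R -> R[i]).
Variables (xi : R -> R[i]) (Psibar : 'I_N -> 'I_N -> R[i]) (K : R[i]).

Definition ordered_region : set (M.-tuple R) :=
  [set x | (forall i, (alpha <= (tnth x i)%:E <= beta)%E) /\
           (forall i j : 'I_M, (i <= j)%N -> tnth x j <= tnth x i)].

Definition Phi_mx (x : M.-tuple R) : 'M[R[i]]_M :=
  \matrix_(i, j) Phi i (tnth x j).

(* insub j is Some j' exactly when j < M, with val j' = val j *)
Definition Psi_mx (x : M.-tuple R) : 'M[R[i]]_N :=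
  \matrix_(i, j) if insub (j : nat) is Some j' then Psi i (tnth x j')
                 else Psibar i j.

Definition ordered_pdf (x : M.-tuple R) : R[i] :=
  K * \det (Phi_mx x) * \det (Psi_mx x) * \prod_(i < M) xi (tnth x i).

Definition varsigma (i : 'I_N) (x : R) : R[i] :=
  if insub (i : nat) is Some i' then Phi i' x * xi x else xi x.

Definition pair_region : set (R * R) :=
  [set p | [/\ (alpha <= p.2%:E)%E, p.2 <= p.1 & (p.1%:E <= beta)%E]].

Definition upper_seg (xl : R) : set R := [set x | xl <= x /\ (x%:E <= beta)%E].
Definition middle_seg (xs xl : R) : set R := [set x | xs <= x <= xl].
Definition lower_seg (xs : R) : set R := [set x | (alpha <= x%:E)%E /\ x <= xs].

Variables l s : 'I_M.

Definition tensorA (xl xs : R) (i j k : 'I_N) : R[i] :=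
  let g x := varsigma i x * Psi j x in
  if (k < l)%N then cintegral lebesgue_measure (upper_seg xl) g
  else if (k == l :> nat) then g xl
  else if (k < s)%N then cintegral lebesgue_measure (middle_seg xs xl) g
  else if (k == s :> nat) then g xs
  else if (k < M)%N then cintegral lebesgue_measure (lower_seg xs) g
  else if (i < k)%N then 0
  else Psibar j k.

(* absolute convergence of the integrals that actually occur in tensorA:
   an index k < l, l < k < s, or s < k < M must exist *)
Definition tensorA_well_defined :=
  forall xl xs, pair_region (xl, xs) -> forall i j : 'I_N,
    let g x := varsigma i x * Psi j x in
    [/\ (0 < l)%N -> cintegrable lebesgue_measure (upper_seg xl) g,
        (l.+1 < s)%N -> cintegrable lebesgue_measure (middle_seg xs xl) g &
        (s.+1 < M)%N -> cintegrable lebesgue_measure (lower_seg xs) g].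

(* 1 / ((l-1)! (s-l-1)! (M-s)!) for the corresponding 1-based l and s *)
Definition c_coef : R[i] :=
  ((l`! * (s - l - 1)`! * (M - s - 1)`!)%N%:R)^-1.

End ordered_density.

Arguments ordered_region {R} alpha beta {M}.

(* Main.v *)
Require Import Defs.
From HB Require Import structures.
From mathcomp Require Import all_boot all_order all_algebra all_fingroup.
From mathcomp Require Import all_classical all_reals all_analysis.
From mathcomp Require Import measurable_realfun complex zify ring.

Import Order.TTheory GRing.Theory Num.Theory.
Import numFieldNormedType.Exports.
Local Open Scope classical_set_scope.
Local Open Scope ring_scope.

Set Implicit Arguments.
Unset Strict Implicit.
Unset Printing Implicit Defensive.

(** Write [F] for the density [K det Phi det Psi prod xi] on all of [R^M].

    The tensor comes from an expansion of two determinants.  The [N x N] matrix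
    with entries [varsigma i (x_k)] in the columns [k < M] and the 0/1 pattern
    [k <= i] in the columns [k >= M] is block lower triangular, and its
    determinant is [det Phi prod xi] ([det_varsigma_mx]).  Expanding both this
    determinant and [det Psi] over permutations writes [F x] as [K] times the
    pseudo-determinant of the tensor of pointwise products
    ([ordered_pdf_pseudo_det]).  If [x_l] and [x_s] are fixed and every other
    [x_k] ranges over its own segment, above [x_l], between [x_s] and [x_l], or
    below [x_s], then each term of the expansion is a product of functions of
    one variable each; by Fubini its integral is a product of entries of the
    tensor [A], so that the integral of [F] over this box is [K T(A)]
    ([has_cintegral_pseudo_det]).

    It remains to compare the box with the slice of the ordered region.  Both
    determinants are alternating, so [F] is invariant under all permutations of
    its arguments ([ordered_pdf_permute]).  Hence [F] is nonnegative and
    measurable on the whole cube [alpha <= x_i <= beta], as it is so on the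
    ordered region, to which every point can be sorted.  For the same reason
    restricting one of the three groups of [l], [s - l - 1] and [M - s - 1]
    variables to sorted order divides the integral of [F] by the factorial of
    the size of the group ([ge0_integral_sorted], [ge0_integral_pivoted]); the proof needs the
    invariance of Lebesgue measure under permutations of the coordinates
    ([lebesgue_tuple_permute]) and the nullity of the set of tuples with a
    repeated entry ([lebesgue_tuple_ties]).  Tonelli's theorem, with the
    coordinates [l] and [s] moved to the front ([ge0_integral_insert2]), then
    identifies [c(l,s) K T(A)] as the density of the pair. *)

(** * Lebesgue measure on tuples and permutations of the coordinates *)

Definition permute {T : Type} {n} (sigma : 'S_n) (x : n.-tuple T) : n.-tuple T :=
  [tuple tnth x (sigma i) | i < n].

Lemma tnth_permute {T : Type} {n} (sigma : 'S_n) (x : n.-tuple T) i :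
  tnth (permute sigma x) i = tnth x (sigma i).
Proof. exact: tnth_mktuple. Qed.

Lemma permuteM {T : Type} {n} (sigma tau : 'S_n) (x : n.-tuple T) :
  permute sigma (permute tau x) = permute (sigma * tau)%g x.
Proof. by apply: eq_from_tnth => i; rewrite !tnth_permute permM. Qed.

Lemma permute1 {T : Type} {n} (x : n.-tuple T) : permute 1%g x = x.
Proof. by apply: eq_from_tnth => i; rewrite tnth_permute perm1. Qed.

Lemma permuteK {T : Type} {n} (sigma : 'S_n) :
  cancel (@permute T n sigma) (permute sigma^-1%g).
Proof. by move=> x; rewrite permuteM mulVg permute1. Qed.

Lemma measurable_permute d (T : measurableType d) n (sigma : 'S_n) :
  measurable_fun setT (@permute T n sigma).
Proof.
apply/measurable_fun_tnthP => i.
rewrite (_ : _ \o _ = (@tnth n T)^~ (sigma i)); first exact: measurable_tnth.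
by apply/funext => x /=; rewrite tnth_permute.
Qed.

Section lebesgue_tuple_theory.
Context {R : realType}.
Local Notation leb := (@lebesgue_measure R).

Definition box {n} (B : 'I_n -> set R) : set (n.-tuple R) :=
  [set x | forall i, B i (tnth x i)].

Lemma measurable_box n (B : 'I_n -> set R) :
  (forall i, measurable (B i)) -> measurable (box B).
Proof.
move=> mB; rewrite (_ : box B = \bigcap_(i in [set: 'I_n])
    (fun x : n.-tuple R => tnth x i) @^-1` B i); last first.
  by apply/seteqP; split => x /= + i => [/(_ i)//|]; exact.
apply: fin_bigcap_measurable => // i _.
by rewrite -[X in measurable X]setTI; exact: measurable_tnth.
Qed.

Let boxes n : set (set (n.-tuple R)) :=
  [set box B | B in [set B : 'I_n -> set R | forall i, measurable (B i)]].

Let boxes_generate n : @measurable _ (n.-tuple R) = <<s @boxes n >>.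
Proof.
apply/seteqP; split; last first.
  apply: smallest_sub; first exact: sigma_algebra_measurable.
  by move=> _ [B mB <-]; exact: measurable_box.
apply: smallest_sub; first exact: smallest_sigma_algebra.
move=> A; rewrite -bigcup_seq/= => -[i _ [C mC <-]].
apply: sub_sigma_algebra; exists (fun j => if j == i then C else setT).
  by move=> j; case: ifP.
apply/seteqP; split => x; rewrite /box /=.
  by move=> /(_ i); rewrite eqxx.
by move=> [_ Cx] j; case: eqP => // ->.
Qed.

Lemma lebesgue_box n (B : 'I_n -> set R) : (forall i, measurable (B i)) ->
  lebesgue_tuple R n (box B) = (\prod_(i < n) leb (B i))%E.
Proof. exact: lebesgue_tuple_box. Qed.

(** Boxes form a generating pi-system, and a permutation of the coordinates
    only permutes the factors of the volume of a box. *)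
Lemma lebesgue_tuple_permute n (sigma : 'S_n) (A : set (n.-tuple R)) :
  measurable A ->
  lebesgue_tuple R n (permute sigma @^-1` A) = lebesgue_tuple R n A.
Proof.
have mp := @measurable_permute _ R n sigma.
pose cell k : set (n.-tuple R) :=
  box (fun=> `[- (k%:R : R), k%:R]%classic).
pose mf : {mfun (n.-tuple R) >-> (n.-tuple R)} :=
  HB.pack (permute sigma) (isMeasurableFun.Build _ _ _ _ _ mp).
move=> mA; symmetry.
apply: (measure_unique (@boxes n) cell (@boxes_generate n) _ _ _
  (lebesgue_tuple R n) (pushforward (lebesgue_tuple R n) mf) _ _ _ mA).
- move=> _ _ [B mB <-] [C mC <-]; exists (fun i => B i `&` C i).
    by move=> i; exact: measurableI.
  apply/seteqP; split => x; rewrite /box /=; first by move=> h; split=> i; have [] := h i.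
  by move=> [h k] i; split.
- by move=> k; exists (fun=> `[- (k%:R : R), k%:R]%classic).
- apply/seteqP; split => // x _.
  exists (Num.truncn (\sum_(i < n) `|tnth x i|)).+1 => // i /=.
  rewrite in_itv /= -ler_norml.
  rewrite (le_trans _ (ltW (truncnS_gt _)))//.
  by rewrite (bigD1 i)//= lerDl sumr_ge0.
- move=> _ [B mB <-]; rewrite /= /pushforward lebesgue_box//.
  rewrite (_ : _ @^-1` _ = box (fun i => B ((sigma^-1)%g i))); last first.
    apply/seteqP; split => x; rewrite /box /= => h i; last first.
      by have := h (sigma i); rewrite permK tnth_permute.
    by have := h ((sigma^-1)%g i); rewrite tnth_permute permKV.
  rewrite lebesgue_box//.
  rewrite [RHS](reindex_inj (@perm_inj _ sigma))/=.
  by apply: eq_bigr => i _; rewrite permK.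
- move=> k; suff H : (lebesgue_tuple R n (cell k) < +oo)%E by exact: H.
  rewrite -ge0_fin_numE; last exact: measure_ge0.
  rewrite lebesgue_box//.
  apply: (big_ind (fun x : \bar R => x \is a fin_num)) => // [x y|i _].
    exact: fin_numM.
  by rewrite lebesgue_measure_itv /=; case: ifP.
Qed.

Section integrals.
Local Open Scope ereal_scope.

Lemma ge0_integral_permute n (sigma : 'S_n) (D : set (n.-tuple R))
    (h : n.-tuple R -> \bar R) :
  measurable D -> measurable_fun D h -> (forall x, D x -> 0 <= h x) ->
  \int[lebesgue_tuple R n]_(x in permute sigma @^-1` D) h (permute sigma x) =
  \int[lebesgue_tuple R n]_(x in D) h x.
Proof.
move=> mD mh h0; have mp := @measurable_permute _ R n sigma.
rewrite -(ge0_integral_pushforward mp)//; last by move=> x /set_mem/h0.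
apply: eq_measure_integral => A mA _; exact: lebesgue_tuple_permute.
Qed.

Lemma ge0_integral_tuple_cons n (h : n.+1.-tuple R -> \bar R) :
  measurable_fun setT h -> (forall x, 0 <= h x) ->
  \int[lebesgue_tuple R n.+1]_x h x =
  \int[leb \x lebesgue_tuple R n]_p h (tuple_consp p).
Proof.
move=> mh h0.
have mC : measurable_fun [set: measurableTypeR R * n.-tuple R] (@tuple_consp R n).
  exact: measurable_tuple_consp.
rewrite -[RHS](ge0_integral_pushforward mC _ measurableT mh)//.
Qed.

End integrals.

Lemma measurable_tie n (i j : 'I_n) :
  measurable [set x : n.-tuple R | tnth x i = tnth x j].
Proof.
rewrite (_ : [set _ | _] = setT `&`
    ((fun x : n.-tuple R => tnth x i - tnth x j) @^-1` [set 0])).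
  by apply: measurable_funB => //; exact: measurable_tnth.
apply/seteqP; split => x /=; first by move=> ->; rewrite subrr.
by move=> [_ /eqP]; rewrite subr_eq0 => /eqP.
Qed.

Lemma lebesgue_tuple_tie n (i j : 'I_n) : i != j ->
  lebesgue_tuple R n [set x | tnth x i = tnth x j] = 0%E.
Proof.
elim: n i j => [|n IH] i j ij; first by case: i {ij}.
wlog ij_le : i j ij / (i <= j)%N.
  move=> H; have [/H->//|/ltnW/H<-] := leqP i j; last by rewrite eq_sym.
  by congr (lebesgue_tuple R _ _); apply/seteqP; split.
pose T := [set x : n.+1.-tuple R | tnth x i = tnth x j].
rewrite -/T.
have -> : lebesgue_tuple R n.+1 T =
  (leb \x lebesgue_tuple R n)%E (@tuple_consp R n @^-1` T) by [].
case: (unliftP ord0 j) ij ij_le @T => [j' ->|->]; last first.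
  by rewrite leqn0 => /negP.
case: (unliftP ord0 i) => [i' ->|->] ij _ T; last first.
  have mE : measurable (@tuple_consp R n @^-1` T).
    rewrite -[X in measurable X]setTI; apply: measurable_tuple_consp => //.
    exact: measurable_tie.
  (* Integrating over the head first, each section is a single point. *)
  rewrite -(setIT (_ @^-1` _)) -integral_indic// fubini_tonelli2//; last first.
    exact/measurable_EFinP/measurable_indic.
  apply: integral0_eq => t _; rewrite /fubini_G.
  rewrite (_ : (fun x => _) = fun x => (\1_[set tnth t j'] x)%:E).
    by rewrite integral_indic// setIT; exact: lebesgue_measure_set1.
  apply/funext => x; congr (_%:E); rewrite !indicE; congr (_%:R).
  congr nat_of_bool; apply/idP/idP; rewrite !inE /T /= tnth0 tnthS; exact.
rewrite (_ : _ @^-1` T = setT `*` [set x | tnth x i' = tnth x j']).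
  rewrite product_measure1E//; last exact: measurable_tie.
  by rewrite [X in (_ * X)%E]IH ?mule0//; apply: contra ij => /eqP->.
by apply/seteqP; split => -[x t]; rewrite /T /= !tnthS => // -[].
Qed.

Lemma lebesgue_tuple_ties n (T := [set x : n.-tuple R | ~ injective (tnth x)]) :
  measurable T /\ lebesgue_tuple R n T = 0%E.
Proof.
have TE : T = \big[setU/set0]_(p : 'I_n * 'I_n | p.1 != p.2)
    [set x | tnth x p.1 = tnth x p.2].
  rewrite -(bigcup_pred [pred p : 'I_n * 'I_n | p.1 != p.2]).
  apply/seteqP; split => x; rewrite /T /=; last first.
    by move=> [[i j] /= /eqP ij xij] /(_ _ _ xij).
  apply: contra_notP => h i j xij; apply: contra_notP h => /eqP ij.
  by exists (i, j).
have mT : measurable T.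
  by rewrite TE; apply: bigsetU_measurable => p _; exact: measurable_tie.
split=> //; apply: measure_negligible => //; rewrite TE.
apply: big_ind => [|A B nA nB|p pP]; [exact: negligible_set0|exact: negligibleU|].
apply/negligibleP; first exact: measurable_tie.
exact: lebesgue_tuple_tie.
Qed.

End lebesgue_tuple_theory.

(** * Sorting some of the coordinates *)

Section sorting.
Context {R : realType} {n : nat}.
Implicit Types (A : {set 'I_n}) (x : n.-tuple R).

Definition ordered_by (r : rel 'I_n) : set (n.-tuple R) :=
  [set x | forall i j, r i j -> tnth x j <= tnth x i].

Lemma measurable_ordered_by r : measurable (ordered_by r).
Proof.
rewrite (_ : ordered_by r = \bigcap_(p in [set: 'I_n * 'I_n])
    if r p.1 p.2 then [set x | tnth x p.2 <= tnth x p.1] else setT); last first.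
  apply/seteqP; split => x /=.
    by move=> rx [i j] _ /=; case: ifP => //; exact: rx.
  by move=> h i j rij; have /= := h (i, j) I; rewrite rij.
apply: fin_bigcap_measurable => // -[i j] _ /=; case: ifP => // _.
rewrite (_ : [set _ | _] = setT `&`
    ((fun x : n.-tuple R => tnth x i - tnth x j) @^-1` `[0, +oo[%classic)).
  by apply: measurable_funB => //; exact: measurable_tnth.
by apply/seteqP; split => x /=; rewrite in_itv/= andbT subr_ge0//; case.
Qed.

Lemma ordered_by_permute (r : rel 'I_n) (s : 'S_n) x :
  (forall i j, r i j -> r (s i) (s j)) -> ordered_by r x ->
  ordered_by r (permute s x).
Proof. by move=> rs rx i j /rs/rx; rewrite !tnth_permute. Qed.

Definition sorted_on A : set (n.-tuple R) :=
  ordered_by [rel i j | [&& i \in A, j \in A & (i < j)%N]].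

(** Among the permutations [s] supported on [A], one that minimizes the sum of
    the [i * x_(s i)] sorts [x] on [A]: exchanging two entries in the wrong order
    would lower that sum. *)
Lemma exists_sorting A x : exists2 s : 'S_n, perm_on A s & sorted_on A (permute s x).
Proof.
pose w (s : 'S_n) := \sum_(i < n) (i : nat)%:R * tnth x (s i).
have [s sA s_min] := @arg_minP _ _ _ (1%g : 'S_n) (perm_on A) w (perm_on1 A).
exists s => // i j /and3P[/= iA jA ij]; rewrite !tnth_permute leNgt; apply/negP => xij.
have tA : perm_on A (tperm i j).
  apply/fintype.subsetP => k; rewrite inE.
  by case: tpermP => [->|->|_ _] //; rewrite eqxx.
have /s_min : perm_on A (tperm i j * s)%g by exact: perm_onM.
rewrite leNgt => /negP; apply.
have ji : j != i by rewrite -val_eqE /= gtn_eqF.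
rewrite /w (bigD1 i)//= [ltRHS](bigD1 i)//= (bigD1 j)//= [in ltRHS](bigD1 j)//=.
rewrite !permM tpermL tpermR !addrA ltr_leD//.
  rewrite -subr_gt0 (_ : _ - _ = ((j : nat)%:R - (i : nat)%:R) *
    (tnth x (s j) - tnth x (s i))).
    by rewrite mulr_gt0 ?subr_gt0// ltr_nat.
  rewrite mulrBl !mulrBr; ring.
rewrite le_eqVlt; apply/orP; left; apply/eqP; apply: eq_bigr => k /andP[ki kj].
by rewrite permM tpermD// eq_sym.
Qed.

(** The least point moved by [p] could neither be mapped below itself, where [p]
    is the identity, nor above itself, since its preimage would then be a smaller
    point that is moved as well. *)
Lemma perm_on_increasing_id A (p : 'S_n) : perm_on A p ->
  {in A &, forall i j : 'I_n, (i < j)%N -> (p i < p j)%N} -> p = 1%g.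
Proof.
move=> pA p_inc; apply/permP => i; rewrite perm1.
have [m] := ubnP (i : nat); elim: m i => // m IH i; rewrite ltnS => im.
have [iA|iA] := boolP (i \in A); last exact: out_perm pA iA.
apply/val_inj/eqP; rewrite /= eqn_leq; apply/andP; split; last first.
  rewrite leqNgt; apply/negP => pi_i.
  have piA : p i \in A by rewrite perm_closed.
  have := p_inc _ _ piA iA pi_i.
  by rewrite (IH (p i)) ?ltnn// (leq_trans pi_i).
rewrite leqNgt; apply/negP => i_pi.
have [j pj] : exists j, p j = i by exists ((p^-1)%g i); rewrite permKV.
have jA : j \in A by rewrite -(perm_closed _ pA) pj.
have [ij|ji|/val_inj ij] := ltngtP i j.
- by have /= := p_inc _ _ iA jA ij; rewrite pj ltnNge (ltnW i_pi).
- have ij : i = j by rewrite -{1}pj; exact: IH (leq_trans ji im).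
  by rewrite ij ltnn in ji.
- by rewrite {2}ij pj ltnn in i_pi.
Qed.

Lemma sorting_unique A x (s t : 'S_n) : injective (tnth x) ->
  perm_on A s -> perm_on A t ->
  sorted_on A (permute s x) -> sorted_on A (permute t x) -> s = t.
Proof.
move=> x_inj sA tA ss st.
suff : (s * t^-1 = 1)%g by move/eqP; rewrite -eq_mulgV1 => /eqP.
have pA : perm_on A (s * t^-1)%g by apply: perm_onM => //; rewrite perm_onV.
apply: (perm_on_increasing_id pA) => i j iA jA ij.
set p := (s * t^-1)%g in pA *.
have tp k : t (p k) = s k by rewrite permM permKV.
rewrite ltnNge leq_eqVlt; apply/norP; split.
  by rewrite val_eqE (inj_eq perm_inj) -val_eqE /= gtn_eqF.
apply/negP => pji.
have := st (p j) (p i); rewrite /= !perm_closed// jA iA pji !tnth_permute !tp.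
move=> /(_ isT) xs.
have := ss i j; rewrite /= iA jA ij !tnth_permute => /(_ isT) xs'.
have /x_inj/perm_inj ijE : tnth x (s i) = tnth x (s j) by apply/le_anti/andP.
by rewrite ijE ltnn in ij.
Qed.

Variable (A : {set 'I_n}) (D : set (n.-tuple R)).
Hypothesis D_sym : forall s x, perm_on A s -> D x -> D (permute s x).

Let permute_sorted s : perm_on A s ->
  D `&` permute s @^-1` sorted_on A = permute s @^-1` (D `&` sorted_on A).
Proof.
move=> sA; apply/seteqP; split => x /= [Dx ?]; split => //; first exact: D_sym.
by rewrite -(permuteK s x); apply: D_sym => //; rewrite perm_onV.
Qed.

(** A symmetric function on [D] is determined by its restriction to the sorted
    tuples, and [D] is covered by finitely many permuted copies of these. *)
Lemma measurable_fun_sorted d (U : measurableType d) (h : n.-tuple R -> U) :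
  measurable D ->
  (forall s x, perm_on A s -> D x -> h (permute s x) = h x) ->
  measurable_fun (D `&` sorted_on A) h -> measurable_fun D h.
Proof.
move=> mD h_sym mh _ Y mY.
have mE := mh (measurableI _ _ mD (measurable_ordered_by _)) Y mY.
rewrite (_ : _ `&` _ = \big[setU/set0]_(s | perm_on A s)
    permute s @^-1` (D `&` sorted_on A `&` h @^-1` Y)).
  apply: bigsetU_measurable => s _.
  rewrite -[X in measurable X]setTI; exact: measurable_permute.
rewrite -(bigcup_pred (perm_on A)); apply/seteqP; split => x /=.
  move=> [Dx hx]; have [s sA xs] := exists_sorting A x.
  exists s => //=; rewrite h_sym//; do 2!split => //; exact: D_sym.
move=> [s /= sA [[Dsx _] hx]].
have Dx : D x by rewrite -(permuteK s x); apply: D_sym => //; rewrite perm_onV.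
by split => //=; rewrite -(h_sym s).
Qed.

(** Off the null set of tuples with a repeated entry, [D] is the disjoint union
    of the [#|A|!] regions in which a given permutation of [A] sorts the tuple, and
    all of these contribute equally to the integral of a symmetric function. *)
Lemma ge0_integral_sorted (h : n.-tuple R -> \bar R) :
  measurable D ->
  (forall s x, perm_on A s -> D x -> h (permute s x) = h x) ->
  measurable_fun D h -> (forall x, D x -> (0 <= h x)%E) ->
  (\int[lebesgue_tuple R n]_(x in D) h x =
   ((#|A|)`!)%:R%:E * \int[lebesgue_tuple R n]_(x in D `&` sorted_on A) h x)%E.
Proof.
move=> mD h_sym mh h0.
have [mT T0] := @lebesgue_tuple_ties R n.
set T := [set x | _] in mT T0.
have mS : measurable (sorted_on A) by exact: measurable_ordered_by.
have mpS s : measurable (D `&` permute s @^-1` sorted_on A).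
  apply: measurableI => //.
  by rewrite -[X in measurable X]setTI; exact: measurable_permute.
pose E s := (D `&` permute s @^-1` sorted_on A) `\` T.
have DTE : D `\` T = \big[setU/set0]_(s <- enum (perm_on A)) E s.
  rewrite big_enum -(bigcup_pred (perm_on A)); apply/seteqP; split => x /=.
    move=> [Dx Tx]; have [s sA xs] := exists_sorting A x.
    by exists s.
  by move=> [s _ [[Dx _] Tx]].
rewrite (ge0_negligible_integral mT)// DTE ge0_integral_bigsetU//; first last.
- by rewrite -DTE => x [Dx _]; exact: h0.
- by rewrite -DTE; apply: measurable_funS mh => // x [].
- apply/trivIsetP => s t /=; rewrite !mem_enum => sA tA st.
  apply/seteqP; split => // x [[[_ xs] Tx] [[_ xt] _]].
  by move/eqP: st; apply; apply: (sorting_unique _ sA tA xs xt); exact: contrapT.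
- exact: enum_uniq.
- by move=> s; exact: measurableD.
rewrite (eq_big_seq (fun=> \int[lebesgue_tuple R n]_(x in D `&` sorted_on A) h x)%E).
  rewrite big_const_seq count_predT -cardE card_perm.
  rewrite mule_natl /enatmul; case: (_`!) => [//|k].
  by rewrite iteropS iterSr adde0.
move=> s; rewrite mem_enum => sA.
rewrite /E -(ge0_negligible_integral mT)//; last 2 first.
- by apply: measurable_funS mh.
- by move=> x [Dx _]; exact: h0.
rewrite permute_sorted// -[RHS](ge0_integral_permute s)//; last 3 first.
- exact: measurableI.
- by apply: measurable_funS mh => // x [].
- by move=> x [Dx _]; exact: h0.
apply: eq_integral => x /set_mem[Dx _]; rewrite -[in LHS](permuteK s x) h_sym//.
by rewrite perm_onV.
Qed.
End sorting.

(** * Integrals of complex functions and products *)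

Section complex_integral_theory.
Context {R : realType}.
Local Notation C := R[i].
Local Notation Re := (@complex.Re R).
Local Notation Im := (@complex.Im R).
Local Notation leb := (@lebesgue_measure R).

Lemma complexReD (z w : C) : Re (z + w) = Re z + Re w.
Proof. by case: z; case: w. Qed.

Lemma complexImD (z w : C) : Im (z + w) = Im z + Im w.
Proof. by case: z; case: w. Qed.

Lemma complexReM (z w : C) : Re (z * w) = Re z * Re w - Im z * Im w.
Proof. by case: z; case: w. Qed.

Lemma complexImM (z w : C) : Im (z * w) = Re z * Im w + Im z * Re w.
Proof. by case: z; case: w => a b c d /=; rewrite addrC. Qed.

Section has_integral.
Context d (T : measurableType d) (mu : {measure set T -> \bar R}).

Definition has_integral (f : T -> R) (r : R) :=
  mu.-integrable setT (EFin \o f) /\ (\int[mu]_x (f x)%:E = r%:E)%E.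

(** Integrals over the whole space only: an integral over a set is expressed by
    extending the integrand by zero.  A product of such extensions is the
    extension of the product from the box, so that Fubini needs no case
    distinction. *)
Definition has_cintegral (f : T -> C) (v : C) :=
  has_integral (Re \o f) (Re v) /\ has_integral (Im \o f) (Im v).

Lemma has_integralD f g r q : has_integral f r -> has_integral g q ->
  has_integral (fun x => f x + g x) (r + q).
Proof.
move=> [fi fE] [gi gE]; split.
  by have := integrableD measurableT fi gi.
by under eq_integral do rewrite EFinD; rewrite integralD// fE gE.
Qed.

Lemma has_integralZ c f r : has_integral f r ->
  has_integral (fun x => c * f x) (c * r).
Proof.
move=> [fi fE]; split; first by have := integrableZl measurableT c fi.
by under eq_integral do rewrite EFinM; rewrite integralZl// fE.
Qed.

Lemma has_integralB f g r q : has_integral f r -> has_integral g q ->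
  has_integral (fun x => f x - g x) (r - q).
Proof.
move=> fr /(has_integralZ (-1)); under eq_fun do rewrite mulN1r.
by rewrite mulN1r; exact: has_integralD.
Qed.

Lemma eq_has_cintegral f g v w : f =1 g -> v = w ->
  has_cintegral f v -> has_cintegral g w.
Proof. by move=> /funext -> ->. Qed.

Lemma has_cintegralD f g v w : has_cintegral f v -> has_cintegral g w ->
  has_cintegral (fun x => f x + g x) (v + w).
Proof.
move=> [fR fI] [gR gI]; split.
  have := has_integralD fR gR.
  by congr has_integral; [apply/funext => x|]; rewrite /= complexReD.
have := has_integralD fI gI.
by congr has_integral; [apply/funext => x|]; rewrite /= complexImD.
Qed.

Lemma has_cintegralZ c f v : has_cintegral f v ->
  has_cintegral (fun x => c * f x) (c * v).
Proof.
move=> [fR fI]; split.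
  have := has_integralB (has_integralZ (Re c) fR) (has_integralZ (Im c) fI).
  by congr has_integral; [apply/funext => x|]; rewrite /= complexReM.
have := has_integralD (has_integralZ (Re c) fI) (has_integralZ (Im c) fR).
by congr has_integral; [apply/funext => x|]; rewrite /= complexImM.
Qed.

Lemma has_cintegral0 : has_cintegral (fun=> 0) 0.
Proof.
by split; (split; [exact: integrable0|exact: integral0]).
Qed.

Lemma has_cintegral_sum (I : Type) (s : seq I) (P : pred I) (f : I -> T -> C) v :
  (forall i, has_cintegral (f i) (v i)) ->
  has_cintegral (fun x => \sum_(i <- s | P i) f i x) (\sum_(i <- s | P i) v i).
Proof.
move=> fv; elim: s => [|i s IH].
  by under eq_fun do rewrite big_nil; rewrite big_nil; exact: has_cintegral0.
under eq_fun do rewrite big_cons; rewrite big_cons; case: (P i) => //.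
exact: has_cintegralD.
Qed.

(** The real and imaginary parts are dominated by the modulus. *)
Lemma cintegrable_has_cintegral (D : set T) (f : T -> C) : measurable D ->
  cintegrable mu D f ->
  has_cintegral (fun x => if x \in D then f x else 0) (cintegral mu D f).
Proof.
move=> mD [[mR mI] foo].
have mN : measurable_fun D (fun x => (Re `|f x|)%:E).
  apply/measurable_EFinP.
  rewrite (_ : (fun x => _) =
    fun x => Num.sqrt ((Re (f x)) ^+ 2 + (Im (f x)) ^+ 2)); last first.
    by apply/funext => x; rewrite normc_def.
  apply: (@measurableT_comp _ _ _ _ _ _ (@Num.sqrt R)).
    exact: continuous_measurable_fun (@sqrt_continuous R).
  by apply: measurable_funD; exact: measurable_funX.
have dominated (p : C -> R) : p 0 = 0 -> measurable_fun D (p \o f) ->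
    (forall z, `|p z| <= Re `|z|) ->
    has_integral (p \o (fun x => if x \in D then f x else 0))
      (Rintegral mu D (p \o f)).
  move=> p0 mp ple.
  have fi : mu.-integrable D (EFin \o (p \o f)).
    apply/integrableP; split; first exact/measurable_EFinP.
    apply: le_lt_trans foo; apply: ge0_le_integral => //.
    - by apply/measurable_EFinP/measurableT_comp.
    - by move=> x _; rewrite lee_fin (le_trans _ (ple _)).
  have gE : EFin \o (p \o (fun x => if x \in D then f x else 0)) =
      (EFin \o (p \o f)) \_ D.
    by apply/funext => x; rewrite patchE /=; case: ifP => //; rewrite p0.
  split; first by rewrite gE; apply/(integrable_mkcond _ mD).
  rewrite [LHS](_ : _ = \int[mu]_x ((EFin \o (p \o f)) \_ D) x)%E; last first.
    by rewrite -gE.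
  by rewrite -integral_mkcond /Rintegral fineK//; exact: integrable_fin_num.
split; apply: dominated => // z; rewrite normc_def /= -sqrtr_sqr ler_sqrt.
- by rewrite lerDl sqr_ge0.
- by rewrite addr_ge0 ?sqr_ge0.
- by rewrite lerDr sqr_ge0.
- by rewrite addr_ge0 ?sqr_ge0.
Qed.

End has_integral.

Section tensor.
Context d1 d2 (X : measurableType d1) (Y : measurableType d2).
Variables (m1 : {sigma_finite_measure set X -> \bar R}).
Variables (m2 : {sigma_finite_measure set Y -> \bar R}).

Lemma has_integral_tensor f g r q :
  has_integral m1 f r -> has_integral m2 g q ->
  has_integral (m1 \x m2)%E (fun p => f p.1 * g p.2) (r * q).
Proof.
move=> [fi fE] [gi gE].
have mf : measurable_fun setT f by apply/measurable_EFinP; exact: measurable_int fi.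
have mg : measurable_fun setT g by apply/measurable_EFinP; exact: measurable_int gi.
have mfg : measurable_fun setT (EFin \o (fun p : X * Y => f p.1 * g p.2)).
  apply/measurable_EFinP; apply: measurable_funM.
    exact: (measurableT_comp mf measurable_fst).
  exact: (measurableT_comp mg measurable_snd).
have int_fg : (m1 \x m2)%E.-integrable setT
    (EFin \o (fun p : X * Y => f p.1 * g p.2)).
  apply/(integrable12ltyP _ _ mfg).
  have absE x : (\int[m2]_y `|(f x * g y)%:E| =
      `|(f x)%:E| * \int[m2]_y `|(g y)%:E|)%E.
    under eq_integral do rewrite EFinM abseM.
    by rewrite ge0_integralZl//; do 2 apply: measurableT_comp => //.
  under eq_integral do rewrite /= absE.
  rewrite ge0_integralZr//; [|by do 2 apply: measurableT_comp => //|exact: integral_ge0].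
  have [_ foo] := integrableP _ _ _ fi; have [_ goo] := integrableP _ _ _ gi.
  rewrite lte_mul_pinfty//; first exact: integral_ge0.
  by rewrite ge0_fin_numE//; exact: integral_ge0.
split=> //; rewrite -integral12_prod_meas1//.
rewrite (_ : fubini_F _ _ = fun x => q%:E * (f x)%:E)%E; last first.
  apply/funext => x; rewrite /fubini_F -gE muleC -integralZl//.
by rewrite integralZl// fE -EFinM mulrC.
Qed.

Lemma has_cintegral_tensor f g v w :
  has_cintegral m1 f v -> has_cintegral m2 g w ->
  has_cintegral (m1 \x m2)%E (fun p => f p.1 * g p.2) (v * w).
Proof.
move=> [fR fI] [gR gI]; split.
  have := has_integralB (has_integral_tensor fR gR) (has_integral_tensor fI gI).
  by congr has_integral; [apply/funext => x|]; rewrite /= complexReM.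
have := has_integralD (has_integral_tensor fR gI) (has_integral_tensor fI gR).
by congr has_integral; [apply/funext => x|]; rewrite /= complexImM.
Qed.

End tensor.

Lemma has_integral_tuple_cons n (f : n.+1.-tuple R -> R) r :
  has_integral (leb \x lebesgue_tuple R n)%E (f \o @tuple_consp R n) r ->
  has_integral (lebesgue_tuple R n.+1) f r.
Proof.
move=> [fi fE].
have mC : measurable_fun [set: measurableTypeR R * n.-tuple R] (@tuple_consp R n).
  exact: measurable_tuple_consp.
(* [tuple_consp] has a measurable inverse. *)
have mf : measurable_fun setT f.
  have mh : measurable_fun setT (f \o @tuple_consp R n).
    by apply/measurable_EFinP; exact: measurable_int fi.
  rewrite (_ : f = (f \o @tuple_consp R n) \o
      (fun t => (thead t, [tuple of behead t]))).
    apply: (measurableT_comp mh); apply/measurable_fun_pair => /=.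
      exact: measurable_tnth.
    exact: measurable_behead.
  by apply/funext => t /=; congr f; rewrite [LHS]tuple_eta; exact: val_inj.
have mEf : measurable_fun setT (EFin \o f) by exact/measurable_EFinP.
split.
  exact: (integrable_pushforward mC mEf (mu := (leb \x lebesgue_tuple R n)%E)).
by rewrite -fE; exact: (integral_pushforward mC mEf (mu := (leb \x lebesgue_tuple R n)%E)).
Qed.

(** Fubini, one coordinate at a time. *)
Lemma has_cintegral_prod n (f : 'I_n -> R -> C) (v : 'I_n -> C) :
  (forall i, has_cintegral leb (f i) (v i)) ->
  has_cintegral (lebesgue_tuple R n)
    (fun t => \prod_(i < n) f i (tnth t i)) (\prod_(i < n) v i).
Proof.
elim: n f v => [|n IH] f v fv.
  rewrite (_ : (fun t => _) = fun=> 1); last by apply/funext => t; rewrite big_ord0.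
  have mu1 : lebesgue_tuple R 0 setT = 1%E by rewrite /= diracT.
  have cstE (e : \bar R) : (\int[lebesgue_tuple R 0]_x cst e x = e)%E.
    by rewrite integral_cst// [X in (_ * X)%E]mu1 mule1.
  have cst c : has_integral (lebesgue_tuple R 0) (fun=> c) c.
    split; last exact: cstE.
    apply/integrableP; split; first exact: (measurable_cst c%:E).
    by have := ltry `|c|; rewrite -(cstE `|c|%:E).
  by rewrite big_ord0; split; exact: cst.
have := has_cintegral_tensor (fv ord0) (IH _ _ (fun i => fv (lift ord0 i))).
rewrite -big_ord_recl => -[hR hI].
split; apply: has_integral_tuple_cons.
  move: hR; congr has_integral; apply/funext => -[x t] /=.
  by rewrite big_ord_recl tnth0; under [in RHS]eq_bigr do rewrite tnthS.
move: hI; congr has_integral; apply/funext => -[x t] /=.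
by rewrite big_ord_recl tnth0; under [in RHS]eq_bigr do rewrite tnthS.
Qed.

End complex_integral_theory.

(** * Determinants *)

Section determinants.

Lemma insub_addn m n : insub (m + n)%N = None :> option 'I_m.
Proof. by rewrite insubF// ltnNge leq_addr. Qed.

(** On a tensor of products the two sums over permutations decouple. *)
Lemma pseudo_det_mul (C : comNzRingType) N (V W : 'M[C]_N) :
  pseudo_det (fun i j k => V i k * W j k) = \det V * \det W.
Proof.
rewrite -[\det V]det_tr -[\det W]det_tr /pseudo_det /determinant mulr_suml.
apply: eq_bigr => u _; rewrite -mulrA; congr (_ * _).
rewrite mulr_sumr; apply: eq_bigr => a _; rewrite big_split /= [RHS]mulrCA.
by congr (_ * (_ * _)); apply: eq_bigr => k _; rewrite mxE.
Qed.

Lemma prod_insub (C : comNzRingType) M N (MN : (M <= N)%N)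
    (p : 'I_N -> 'I_M -> C) (q : 'I_N -> C) :
  \prod_(k < N) (if insub (k : nat) is Some k' then p k k' else q k) =
  \prod_(k < M) p (widen_ord MN k) k * \prod_(k < N | (M <= k)%N) q k.
Proof.
have [n NE] : exists n, N = (M + n)%N by exists (N - M)%N; rewrite subnKC.
subst N; rewrite big_split_ord /= [X in _ = _ * X]big_mkcond big_split_ord /=.
rewrite [X in _ = _ * (X * _)]big1 ?mul1r => [|k _]; last by rewrite leqNgt ltn_ord.
congr (_ * _); apply: eq_bigr => k _.
  by rewrite valK (_ : lshift n k = widen_ord MN k)//; exact: val_inj.
by rewrite insub_addn leq_addr.
Qed.

Context {R : realType}.
Local Notation C := R[i].

(** The factor of the tensor entries that depends on the row index; the last
    columns account for the zeros of the tensor at [M <= k] and [i < k]. *)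
Definition varsigma_mx M N (Phi : 'I_M -> R -> C) (xi : R -> C) (x : M.-tuple R) :
    'M[C]_N :=
  \matrix_(i, k) if insub (k : nat) is Some k' then varsigma Phi xi i (tnth x k')
                 else (k <= i)%N%:R.

(** The columns of index at least [M] make the matrix block lower triangular,
    with a second diagonal block that is lower unitriangular. *)
Lemma det_varsigma_mx M N (Phi : 'I_M -> R -> C) (xi : R -> C) (x : M.-tuple R) :
  (M <= N)%N ->
  \det (varsigma_mx N Phi xi x) = \det (Phi_mx Phi x) * \prod_(i < M) xi (tnth x i).
Proof.
move=> MN; have [n NE] : exists n, N = (M + n)%N by exists (N - M)%N; rewrite subnKC.
subst N; rewrite -[varsigma_mx _ _ _ _]submxK.
set A := ulsubmx _; set D := drsubmx _.
have -> : ursubmx (varsigma_mx (M + n) Phi xi x) = 0.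
  apply/matrixP => i k; rewrite !mxE /= insub_addn leqNgt.
  by rewrite (leq_trans (ltn_ord i))// leq_addr.
rewrite det_lblock.
have -> : A = Phi_mx Phi x *m diag_mx (\row_k xi (tnth x k)).
  apply/matrixP => i k; rewrite mul_mx_diag !mxE /= valK.
  by rewrite /varsigma /= valK.
rewrite det_mulmx det_diag (_ : \det D = 1) ?mulr1.
  by congr (_ * _); apply: eq_bigr => k _; rewrite mxE.
rewrite det_trig; first by rewrite big1// => k _; rewrite !mxE /= insub_addn leqnn.
by apply/is_trig_mxP => i k ik; rewrite !mxE /= insub_addn leq_add2l leqNgt ik.
Qed.

Lemma det_Phi_mx_permute M (Phi : 'I_M -> R -> C) (sigma : 'S_M) (x : M.-tuple R) :
  \det (Phi_mx Phi (permute sigma x)) = (-1) ^+ sigma * \det (Phi_mx Phi x).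
Proof.
have -> : Phi_mx Phi (permute sigma x) = col_perm sigma (Phi_mx Phi x).
  by apply/matrixP => i k; rewrite !mxE tnth_permute.
by rewrite col_permE det_mulmx det_perm odd_permV mulrC.
Qed.

(** Only the first [M] columns depend on [x], so the permutation acts by right
    multiplication with a permutation matrix extended by an identity block. *)
Lemma det_Psi_mx_permute M N (Psi : 'I_N -> R -> C) (Psibar : 'I_N -> 'I_N -> C)
    (sigma : 'S_M) (x : M.-tuple R) : (M <= N)%N ->
  \det (Psi_mx Psi Psibar (permute sigma x)) =
  (-1) ^+ sigma * \det (Psi_mx Psi Psibar x).
Proof.
move=> MN; have [n NE] : exists n, N = (M + n)%N by exists (N - M)%N; rewrite subnKC.
subst N.
have -> : Psi_mx Psi Psibar (permute sigma x) = Psi_mx Psi Psibar x *m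
    block_mx (perm_mx sigma^-1) 0 0 1%:M.
  rewrite -[in RHS](hsubmxK (Psi_mx Psi Psibar x)) mul_row_block.
  rewrite !mulmx0 addr0 add0r mulmx1 -col_permE -[LHS]hsubmxK.
  congr row_mx; apply/matrixP => i k; rewrite !mxE /= ?insub_addn//.
  by rewrite !valK tnth_permute.
by rewrite det_mulmx det_lblock det1 mulr1 det_perm odd_permV mulrC.
Qed.

(** Both determinants are alternating in [x], so the signs cancel. *)
Lemma ordered_pdf_permute M N (Phi : 'I_M -> R -> C) (Psi : 'I_N -> R -> C)
    (xi : R -> C) (Psibar : 'I_N -> 'I_N -> C) (K : C) (sigma : 'S_M) x :
  (M <= N)%N ->
  ordered_pdf Phi Psi xi Psibar K (permute sigma x) =
  ordered_pdf Phi Psi xi Psibar K x.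
Proof.
move=> MN; rewrite /ordered_pdf det_Phi_mx_permute det_Psi_mx_permute//.
congr (_ * _); last first.
  rewrite [RHS](reindex_inj (@perm_inj _ sigma)) /=.
  by apply: eq_bigr => i _; rewrite tnth_permute.
by rewrite -!mulrA (mulrCA (\det (Phi_mx Phi x))) signrMK.
Qed.

Lemma ordered_pdf_pseudo_det M N (Phi : 'I_M -> R -> C) (Psi : 'I_N -> R -> C)
    (xi : R -> C) (Psibar : 'I_N -> 'I_N -> C) (K : C) (x : M.-tuple R) :
  (M <= N)%N ->
  ordered_pdf Phi Psi xi Psibar K x =
  K * pseudo_det (fun i j k : 'I_N =>
    varsigma_mx N Phi xi x i k * Psi_mx Psi Psibar x j k).
Proof.
move=> MN; rewrite pseudo_det_mul det_varsigma_mx// /ordered_pdf -!mulrA.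
by congr (_ * (_ * _)); rewrite mulrC.
Qed.

End determinants.

(** * Isolating two coordinates *)

Section insert2.
Context {R : realType}.
Local Notation leb := (@lebesgue_measure R).

Lemma perm_to_front m (l s : 'I_m.+2) : l != s ->
  exists tau : 'S_m.+2, tau l = ord0 /\ tau s = lift ord0 ord0.
Proof.
move=> ls; pose s' := tperm l ord0 s.
have s'0 : s' != ord0 by rewrite /s' -[X in _ != X](tpermL l) (inj_eq perm_inj) eq_sym.
exists (tperm l ord0 * tperm s' (lift ord0 ord0))%g.
by rewrite !permM tpermL tpermD// -/s' tpermL.
Qed.

Variables (m : nat) (tau : 'S_m.+2).

(** Tonelli splits off the leading coordinates of a tuple; [tau], which moves the
    two positions of interest to the front, brings them into that place. *)
Definition insert2 (p : R * R) (t : m.-tuple R) : m.+2.-tuple R :=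
  permute tau (tuple_consp (p.1, tuple_consp (p.2, t))).

Definition other_index (j : 'I_m) : 'I_m.+2 :=
  (tau^-1)%g (lift ord0 (lift ord0 j)).

Lemma tnth_insert2_fst p t i : tau i = ord0 -> tnth (insert2 p t) i = p.1.
Proof. by move=> ti; rewrite tnth_permute ti tnth0. Qed.

Lemma tnth_insert2_snd p t i : tau i = lift ord0 ord0 -> tnth (insert2 p t) i = p.2.
Proof. by move=> ti; rewrite tnth_permute ti tnthS tnth0. Qed.

Lemma tnth_insert2_other p t j : tnth (insert2 p t) (other_index j) = tnth t j.
Proof. by rewrite tnth_permute permKV !tnthS. Qed.

Lemma other_indexP (P : 'I_m.+2 -> Prop) i0 i1 :
  tau i0 = ord0 -> tau i1 = lift ord0 ord0 ->
  P i0 -> P i1 -> (forall j, P (other_index j)) -> forall i, P i.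
Proof.
move=> t0 t1 P0 P1 Pj i; rewrite -(permK tau i).
case: (unliftP ord0 (tau i)) => [k ->|->]; last by rewrite -t0 permK.
case: (unliftP ord0 k) => [j ->|->]; first exact: Pj.
by rewrite -t1 permK.
Qed.

Lemma prod_other_index (C : comNzRingType) (f : 'I_m.+2 -> C) i0 i1 :
  tau i0 = ord0 -> tau i1 = lift ord0 ord0 ->
  \prod_i f i = f i0 * (f i1 * \prod_j f (other_index j)).
Proof.
move=> t0 t1; rewrite (reindex_inj (@perm_inj _ (tau^-1)%g))/=.
have <- : (tau^-1)%g ord0 = i0 by rewrite -t0 permK.
have <- : (tau^-1)%g (lift ord0 ord0) = i1 by rewrite -t1 permK.
by rewrite !big_ord_recl.
Qed.

Lemma measurable_insert2 :
  measurable_fun [set: (measurableTypeR R * measurableTypeR R) * m.-tuple R]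
    (fun q => insert2 q.1 q.2).
Proof.
apply: (measurableT_comp (@measurable_permute _ R _ tau)).
apply: (measurableT_comp (@measurable_tuple_consp R m.+1)).
apply/measurable_fun_pair => /=; first exact: measurableT_comp.
apply: (measurableT_comp (@measurable_tuple_consp R m)).
apply/measurable_fun_pair => //=; exact: measurableT_comp.
Qed.

Variable h : m.+2.-tuple R -> \bar R.
Hypotheses (mh : measurable_fun setT h) (h0 : forall x, (0 <= h x)%E).

Let mhi : measurable_fun setT
  (fun q : (measurableTypeR R * measurableTypeR R) * m.-tuple R => h (insert2 q.1 q.2)).
Proof. exact: (measurableT_comp mh measurable_insert2). Qed.

Local Open Scope ereal_scope.

Lemma measurable_integral_insert2 :
  measurable_fun [set: measurableTypeR R * measurableTypeR R]
    (fun p => \int[lebesgue_tuple R m]_t h (insert2 p t)).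
Proof.
exact: (measurable_fun_fubini_tonelli_F _ mhi (fun=> h0 _)).
Qed.

Lemma ge0_integral_insert2 :
  \int[lebesgue_tuple R m.+2]_x h x =
  \int[leb \x leb]_p \int[lebesgue_tuple R m]_t h (insert2 p t).
Proof.
rewrite -(ge0_integral_permute tau)// preimage_setT.
have mhp : measurable_fun setT (h \o permute tau).
  exact: (measurableT_comp mh (@measurable_permute _ R _ tau)).
rewrite (ge0_integral_tuple_cons mhp); last by move=> ?; exact: h0.
have mC n : measurable_fun [set: measurableTypeR R * n.-tuple R] (@tuple_consp R n).
  exact: measurable_tuple_consp.
rewrite fubini_tonelli1; [|exact: (measurableT_comp mhp (mC _))|by move=> ?; exact: h0].
rewrite [RHS]fubini_tonelli1//=; last 2 first.
- exact: measurable_integral_insert2.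
- by move=> p; exact: integral_ge0.
apply: eq_integral => a _; rewrite /fubini_F.
have mha : measurable_fun setT (fun y => h (permute tau (tuple_consp (a, y)))).
  apply: (measurableT_comp (measurableT_comp mhp (mC m.+1))).
  exact: measurable_fun_pair.
rewrite (ge0_integral_tuple_cons mha)// fubini_tonelli1//.
exact: (measurableT_comp mha (mC _)).
Qed.

End insert2.

(** * The region determined by the two selected coordinates *)

Section pivoted_region.
Context {R : realType}.
Variables (alpha beta : \bar R) (M : nat) (l s : 'I_M).
Hypothesis ls : (l < s)%N.
Implicit Types (x : M.-tuple R) (A B : {set 'I_M}).

Definition cube : set (M.-tuple R) :=
  box (fun=> [set r : R | (alpha <= r%:E <= beta)%E]).

Lemma measurable_cube : measurable cube.
Proof.
apply: measurable_box => _.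
rewrite (_ : [set _ | _] = setT `&`
    (EFin @^-1` [set` Interval (BLeft alpha) (BRight beta)])).
  by apply: EFin_measurable => //; exact: emeasurable_itv.
by apply/seteqP; split => r /=; rewrite in_itv //= => -[].
Qed.

Lemma cube_permute (sigma : 'S_M) x : cube x -> cube (permute sigma x).
Proof. by move=> xc i; rewrite tnth_permute; exact: xc. Qed.

(** The comparisons with the entries at [l] and [s] are kept, those within the
    three groups of other coordinates are dropped.  The slices of this region
    over a value of these two entries are boxes. *)
Definition pivoted_region : set (M.-tuple R) :=
  cube `&` ordered_by [rel i j : 'I_M | (i <= l <= j)%N || (i <= s <= j)%N].

Lemma measurable_pivoted_region : measurable pivoted_region.
Proof. by apply: measurableI; [exact: measurable_cube|exact: measurable_ordered_by]. Qed.

Definition above : {set 'I_M} := [set k : 'I_M | (k < l)%N]%SET.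
Definition between : {set 'I_M} := [set k : 'I_M | (l < k < s)%N]%SET.
Definition below : {set 'I_M} := [set k : 'I_M | (s < k)%N]%SET.

Lemma card_ord_itv a b : (b <= M)%N ->
  #|[set k : 'I_M | (a <= k < b)%N]%SET| = (b - a)%N.
Proof.
move=> bM; rewrite cardsE -sum1_card -[RHS]muln1 -sum_nat_const_nat.
rewrite (big_nat_widen _ _ _ _ _ bM) big_geq_mkord.
by apply: eq_bigl => k; rewrite andbC.
Qed.

Lemma card_above : #|above| = l.
Proof.
rewrite -[RHS]subn0 -(card_ord_itv 0 (ltnW (ltn_ord l))).
by congr #|pred_of_set _|; apply/setP => k; rewrite !inE.
Qed.

Lemma card_between : #|between| = (s - l - 1)%N.
Proof. by rewrite (card_ord_itv l.+1 (ltnW (ltn_ord s))) -subnDA addn1. Qed.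

Lemma card_below : #|below| = (M - s - 1)%N.
Proof.
rewrite -subnDA addn1 -card_ord_itv//; congr #|pred_of_set _|.
by apply/setP => k; rewrite !inE ltn_ord andbT.
Qed.

Lemma ordered_regionE :
  ordered_region alpha beta = cube `&` sorted_on [set: 'I_M]%SET.
Proof.
apply/seteqP; split => x /= [xc xs]; split=> //.
  by move=> i j /and3P[_ _ /ltnW]; exact: xs.
move=> i j; rewrite leq_eqVlt => /predU1P[/val_inj->//|ij].
by apply: xs; rewrite /= !inE.
Qed.

Lemma ordered_region_pivoted : ordered_region alpha beta =
  pivoted_region `&` sorted_on above `&` sorted_on between `&` sorted_on below.
Proof.
rewrite ordered_regionE; apply/seteqP; split => x /=.
  move=> [xc xs].
  have sub A : sorted_on A x.
    by move=> i j /and3P[/= _ _ ij]; apply: xs; rewrite /= !inE.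
  do 3![split; last exact: sub]; split=> // i j /= ij.
  have [ij'|ji|/val_inj->//] := ltngtP i j; first by apply: xs; rewrite /= !inE.
  by case/orP: ij => /andP[/leq_trans/[apply]]; rewrite leqNgt ji.
move=> [[[[xc xp] xa] xb] xl]; split => // i j /and3P[/= _ _ ij].
have [il|li|/val_inj il] := ltngtP i l.
- have [jl|lj] := ltnP j l; first by apply: xa; rewrite /= !inE il jl.
  by apply: xp; rewrite /= (ltnW il) lj.
- have [is_|si|/val_inj is_] := ltngtP i s.
  + have [js|sj] := ltnP j s.
      by apply: xb; rewrite /= !inE li is_ js (ltn_trans li ij).
    by apply: xp; rewrite /= (ltnW is_) sj orbT.
  + by apply: xl; rewrite /= !inE si ij (ltn_trans si ij).
  + by rewrite is_ in ij *; apply: xp; rewrite /= leqnn (ltnW ij) orbT.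
- by rewrite il in ij *; apply: xp; rewrite /= leqnn ltnW.
Qed.

(** What makes a permutation supported on [A] preserve the comparisons with the
    two pivots. *)
Definition same_side A := {in A &, forall i j : 'I_M,
  [/\ (i <= l)%N = (j <= l)%N, (l <= i)%N = (l <= j)%N,
      (i <= s)%N = (j <= s)%N & (s <= i)%N = (s <= j)%N]}.

Lemma same_side_perm A (sigma : 'S_M) i : same_side A -> perm_on A sigma ->
  [/\ (sigma i <= l)%N = (i <= l)%N, (l <= sigma i)%N = (l <= i)%N,
      (sigma i <= s)%N = (i <= s)%N & (s <= sigma i)%N = (s <= i)%N].
Proof.
move=> sA oA; have [iA|iA] := boolP (i \in A); last by rewrite (out_perm oA).
by apply: sA => //; rewrite perm_closed.
Qed.

Lemma pivoted_region_permute A (sigma : 'S_M) x : same_side A -> perm_on A sigma ->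
  pivoted_region x -> pivoted_region (permute sigma x).
Proof.
move=> sA oA [xc xp]; split; first exact: cube_permute.
apply: ordered_by_permute xp => i j /=.
have [-> _ -> _] := same_side_perm i sA oA.
by have [_ -> _ ->] := same_side_perm j sA oA.
Qed.

Lemma sorted_on_permute A B (sigma : 'S_M) x :
  {in A, forall i, i \notin B} -> perm_on A sigma ->
  sorted_on B x -> sorted_on B (permute sigma x).
Proof.
move=> dAB oA; apply: ordered_by_permute => i j /= /and3P[iB jB ij].
have fix_B k : k \in B -> sigma k = k.
  by move=> kB; apply: (out_perm oA); apply: contraTN kB => /dAB.
by rewrite !fix_B// iB jB.
Qed.

Lemma same_side_fix A (sigma : 'S_M) : same_side A -> perm_on A sigma ->
  sigma l = l /\ sigma s = s.
Proof.
move=> sA oA; have [l1 l2 _ _] := same_side_perm l sA oA.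
have [_ _ s1 s2] := same_side_perm s sA oA.
by split; apply/val_inj/eqP; rewrite eqn_leq ?l1 ?l2 ?s1 ?s2 leqnn.
Qed.

Lemma same_side_above : same_side above.
Proof. by move=> i j; rewrite !inE => il jl; split; lia. Qed.

Lemma same_side_between : same_side between.
Proof. by move=> i j; rewrite !inE => /andP[li is_] /andP[lj js]; split; lia. Qed.

Lemma same_side_below : same_side below.
Proof. by move=> i j; rewrite !inE => si sj; split; lia. Qed.

(** The three groups are sorted one after the other: a permutation of one group
    respects the order already imposed on another. *)
Lemma ge0_integral_pivoted (E : set (M.-tuple R)) (h : M.-tuple R -> \bar R) :
  measurable E ->
  (forall (sigma : 'S_M) x, sigma l = l -> sigma s = s -> E x -> E (permute sigma x)) ->
  (forall (sigma : 'S_M) x, h (permute sigma x) = h x) ->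
  measurable_fun pivoted_region h -> (forall x, pivoted_region x -> (0 <= h x)%E) ->
  (\int[lebesgue_tuple R M]_(x in E `&` pivoted_region) h x =
   (l`! * (s - l - 1)`! * (M - s - 1)`!)%N%:R%:E *
     \int[lebesgue_tuple R M]_(x in E `&` ordered_region alpha beta) h x)%E.
Proof.
move=> mE E_sym h_sym mh h0.
have mD : measurable (E `&` pivoted_region).
  by apply: measurableI => //; exact: measurable_pivoted_region.
have mS A : measurable (sorted_on A : set (M.-tuple R)).
  exact: measurable_ordered_by.
have D_sym A sigma x : same_side A -> perm_on A sigma ->
    (E `&` pivoted_region) x -> (E `&` pivoted_region) (permute sigma x).
  move=> sA oA [Ex px]; have [fl fs] := same_side_fix sA oA.
  by split; [exact: E_sym|exact: pivoted_region_permute sA oA px].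
rewrite (ge0_integral_sorted (A := above))//; first last.
- by move=> x [_ /h0].
- by apply: measurable_funS mh => //; exact: measurable_pivoted_region.
- by move=> sigma x oA; apply: D_sym oA; exact: same_side_above.
rewrite (ge0_integral_sorted (A := between)); first last.
- by move=> x [[_ /h0]].
- by apply: measurable_funS mh; [exact: measurable_pivoted_region|move=> x [[]]].
- by [].
- exact: measurableI.
- move=> sigma x oA [Dx sx]; split; first exact: D_sym same_side_between oA Dx.
  apply: sorted_on_permute oA sx; move=> i; rewrite !inE => /andP[li _].
  by rewrite -leqNgt ltnW.
rewrite (ge0_integral_sorted (A := below)); first last.
- by move=> x [[[_ /h0]]].
- by apply: measurable_funS mh; [exact: measurable_pivoted_region|move=> x [[[]]]].
- by [].
- by do 2 apply: measurableI => //.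
- move=> sigma x oA [[Dx sx] sx']; split; first split.
  + exact: D_sym same_side_below oA Dx.
  + apply: sorted_on_permute oA sx; move=> i; rewrite !inE => si.
    by rewrite -leqNgt ltnW// (ltn_trans ls).
  + apply: sorted_on_permute oA sx'; move=> i; rewrite !inE => si.
    by rewrite negb_and -!leqNgt (ltnW si) orbT.
rewrite card_above card_between card_below !muleA -!EFinM -!natrM.
by rewrite ordered_region_pivoted !setIA.
Qed.

End pivoted_region.

Section insert2_region.
Context {R : realType}.
Variables (alpha beta : \bar R) (m : nat) (l s : 'I_m.+2) (tau : 'S_m.+2).
Hypotheses (ls : (l < s)%N) (tau_l : tau l = ord0) (tau_s : tau s = lift ord0 ord0).

Definition segment (xl xs : R) (k : 'I_m.+2) : set R :=
  if (k < l)%N then upper_seg beta xl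
  else if (k < s)%N then middle_seg xs xl else lower_seg alpha xs.

Lemma other_index_neq j : other_index tau j != l /\ other_index tau j != s.
Proof.
by split; rewrite -(inj_eq (@perm_inj _ tau)) permKV ?tau_l ?tau_s.
Qed.

Lemma pivoted_insert2 p t :
  pivoted_region alpha beta l s (insert2 tau p t) <->
  pair_region alpha beta p /\
  box (fun j => segment p.1 p.2 (other_index tau j)) t.
Proof.
set x := insert2 tau p t.
have xl : tnth x l = p.1 by exact: tnth_insert2_fst.
have xs : tnth x s = p.2 by exact: tnth_insert2_snd.
split=> [[xc xp]|[[ap pp pb] tb]].
  have := xc l; have := xc s; rewrite /= xl xs => /andP[a2 b2] /andP[a1 b1].
  split.
    by split=> //; rewrite -xl -xs; apply: xp; rewrite /= leqnn ltnW.
  move=> j; have [jl js] := other_index_neq j.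
  rewrite /segment -(tnth_insert2_other tau p t); set k := other_index tau j in jl js *.
  have /= /andP[ak bk] := xc k.
  case: (ltngtP k l) jl => [kl _|lk _|/val_inj->]; last by rewrite eqxx.
    by split=> //; rewrite -xl; apply: xp; rewrite /= leqnn ltnW.
  case: (ltngtP k s) js => [ks _|sk _|/val_inj->]; last by rewrite eqxx.
    rewrite /middle_seg /= -xl -xs; apply/andP; split; apply: xp => /=.
      by rewrite leqnn (ltnW ks) orbT.
    by rewrite leqnn (ltnW lk).
  by split=> //; rewrite -xs; apply: xp; rewrite /= leqnn (ltnW sk) orbT.
(* Each coordinate is compared with the pivots separately; transitivity through
   a pivot then gives the comparisons that define the region. *)
have H : forall i, [/\ (alpha <= (tnth x i)%:E <= beta)%E,
    (i <= l)%N -> p.1 <= tnth x i, (l <= i)%N -> tnth x i <= p.1,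
    (i <= s)%N -> p.2 <= tnth x i & (s <= i)%N -> tnth x i <= p.2].
  have ab1 : (alpha <= p.1%:E)%E by rewrite (le_trans ap)// lee_fin.
  have ab2 : (p.2%:E <= beta)%E by rewrite (le_trans _ pb)// lee_fin.
  apply: (other_indexP tau_l tau_s); rewrite ?xl ?xs.
  - by rewrite ab1 pb; split=> //; rewrite leqNgt ls.
  - by rewrite ap ab2; split=> //; rewrite leqNgt ls.
  move=> j; have := tb j; have [jl js] := other_index_neq j.
  rewrite tnth_insert2_other /segment; set k := other_index tau j in jl js *.
  case: (ltngtP k l) jl => [kl _|lk _|/val_inj->]; last by rewrite eqxx.
    move=> [pt tbe].
    have ks := ltn_trans kl ls; rewrite (leqNgt s) ks /=; split=> //.
    - by rewrite tbe (le_trans ab1)// lee_fin.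
    - by move=> _; rewrite (le_trans pp).
  case: (ltngtP k s) js => [ks _|sk _|/val_inj->]; last by rewrite eqxx.
    move=> /andP[pt tp]; split=> //.
    by rewrite (le_trans ap) ?lee_fin// (le_trans _ pb)// lee_fin.
  move=> [at_ tp]; split=> //.
    by rewrite at_ (le_trans _ ab2)// lee_fin.
  by move=> _; rewrite (le_trans tp).
split=> [i|i j /= /orP[]/andP[]]; first by have [] := H i.
  by have [_ h _ _ _] := H i; have [_ _ h' _ _] := H j => /h + /h'; move=> /[swap]; exact: le_trans.
by have [_ _ _ h _] := H i; have [_ _ _ _ h'] := H j => /h + /h'; move=> /[swap]; exact: le_trans.
Qed.

End insert2_region.

(** * The pseudo-determinant as an integral over a box *)

Section tensor_integral.
Context {R : realType}.
Local Notation C := R[i].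
Local Notation leb := (@lebesgue_measure R).
Variables (alpha beta : \bar R) (m N : nat).
Variables (Phi : 'I_m.+2 -> R -> C) (Psi : 'I_N -> R -> C) (xi : R -> C).
Variables (Psibar : 'I_N -> 'I_N -> C) (K : C).
Variables (l s : 'I_m.+2) (tau : 'S_m.+2).
Hypotheses (MN : (m.+2 <= N)%N) (ls : (l < s)%N).
Hypotheses (tau_l : tau l = ord0) (tau_s : tau s = lift ord0 ord0).
Hypothesis wd : tensorA_well_defined alpha beta Phi Psi xi l s.

Local Notation seg := (segment alpha beta l s).

Lemma measurable_segment xl xs k : measurable (seg xl xs k).
Proof.
rewrite /segment; case: ifP => _; last case: ifP => _.
- rewrite (_ : upper_seg _ _ = `[xl, +oo[%classic `&`
      (EFin @^-1` [set` Interval -oo%O (BRight beta)])).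
    apply: measurableI => //; rewrite -[X in measurable X]setTI.
    by apply: EFin_measurable => //; exact: emeasurable_itv.
  by apply/seteqP; split => r /=; rewrite !in_itv /= andbT.
- rewrite (_ : middle_seg _ _ = `[xs, xl]%classic)//.
- rewrite (_ : lower_seg _ _ = (EFin @^-1` [set` Interval (BLeft alpha) +oo%O])
      `&` `]-oo, xs]%classic).
    apply: measurableI => //; rewrite -[X in measurable X]setTI.
    by apply: EFin_measurable => //; exact: emeasurable_itv.
  by apply/seteqP; split => r /=; rewrite !in_itv /= andbT.
Qed.

Lemma cintegrable_segment p (j : 'I_m) (i i' : 'I_N) : pair_region alpha beta p ->
  cintegrable leb (seg p.1 p.2 (other_index tau j))
    (fun x => varsigma Phi xi i x * Psi i' x).
Proof.
case: p => xl xs /wd/(_ i i') /= [hu hm hl].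
have [jl js] := other_index_neq tau_l tau_s j.
rewrite /segment; set k := other_index tau j in jl js *.
case: (ltngtP k l) jl => [kl _|lk _|/val_inj->]; last by rewrite eqxx.
  by apply: hu; exact: leq_ltn_trans kl.
case: (ltngtP k s) js => [ks _|sk _|/val_inj->]; last by rewrite eqxx.
  by apply: hm; exact: leq_ltn_trans ks.
by apply: hl; exact: leq_ltn_trans (ltn_ord k).
Qed.

Let entry (p : R * R) (t : m.-tuple R) i i' (k : 'I_N) : C :=
  varsigma_mx N Phi xi (insert2 tau p t) i k *
  Psi_mx Psi Psibar (insert2 tau p t) i' k.

Let tail (i i' k : 'I_N) : C := (k <= i)%N%:R * Psibar i' k.

Let tensor_entry (p : R * R) (i i' : 'I_N) (k : 'I_m.+2) : C :=
  let g x := varsigma Phi xi i x * Psi i' x in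
  if k == l then g p.1 else if k == s then g p.2
  else cintegral leb (seg p.1 p.2 k) g.

Let tensorA_entry p i i' (k : 'I_N) :
  tensorA alpha beta Phi Psi xi Psibar l s p.1 p.2 i i' k =
  if insub (k : nat) is Some k' then tensor_entry p i i' k' else tail i i' k.
Proof.
rewrite /tensorA; case: insubP => [k' kM k'k|]; last first.
  rewrite -leqNgt => Mk; have lk := leq_trans (ltn_ord l) Mk.
  have sk := leq_trans (ltn_ord s) Mk.
  have [-> -> -> -> ->] : [/\ (k < l)%N = false, (k == l :> nat) = false,
      (k < s)%N = false, (k == s :> nat) = false & (k < m.+2)%N = false].
    by split; lia.
  by rewrite /tail; case: ltnP; rewrite ?mul0r ?mul1r.
rewrite -k'k /tensor_entry /segment ltn_ord -!val_eqE /=.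
by case: (ltngtP k' l) => // lk'; case: (ltngtP k' s) => // k's; exfalso; lia.
Qed.

Let entryE p t i i' (k : 'I_N) : entry p t i i' k =
  if insub (k : nat) is Some k' then
    varsigma Phi xi i (tnth (insert2 tau p t) k') *
    Psi i' (tnth (insert2 tau p t) k')
  else tail i i' k.
Proof. by rewrite /entry !mxE; case: insubP. Qed.

(** Once the two selected variables are fixed, every term in the expansion of the
    density is a product of functions of one variable each, and Fubini turns its
    integral over the box into a product of entries of the tensor. *)
Lemma has_cintegral_pseudo_det p : pair_region alpha beta p ->
  has_cintegral (lebesgue_tuple R m)
    (fun t => if t \in box (fun j => seg p.1 p.2 (other_index tau j))
      then ordered_pdf Phi Psi xi Psibar K (insert2 tau p t) else 0)
    (K * pseudo_det (tensorA alpha beta Phi Psi xi Psibar l s p.1 p.2)).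
Proof.
move=> pr; pose S j := seg p.1 p.2 (other_index tau j).
pose term (u a : 'S_N) t : C :=
  if t \in box S then \prod_(k < N) entry p t (u k) (a k) k else 0.
pose w (k : 'I_m.+2) : 'I_N := widen_ord MN k.
have term_int (u a : 'S_N) : has_cintegral (lebesgue_tuple R m) (term u a)
    (\prod_(k < N) tensorA alpha beta Phi Psi xi Psibar l s p.1 p.2 (u k) (a k) k).
  pose g j x := varsigma Phi xi (u (w (other_index tau j))) x *
    Psi (a (w (other_index tau j))) x.
  have g_int j : has_cintegral leb (fun x => if x \in S j then g j x else 0)
      (cintegral leb (S j) (g j)).
    apply: cintegrable_has_cintegral; first exact: measurable_segment.
    exact: cintegrable_segment.
  pose c k x := varsigma Phi xi (u (w k)) x * Psi (a (w k)) x.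
  (* The two selected variables and the constant columns factor out. *)
  have := has_cintegral_prod g_int; move=> /(has_cintegralZ (c l p.1 * c s p.2 *
    \prod_(k < N | (m.+2 <= k)%N) tail (u k) (a k) k)).
  apply: eq_has_cintegral => [t|].
    rewrite /term; case: ifPn => [/set_mem tS|tS]; last first.
      have [j jS] : exists j, ~ S j (tnth t j).
        by apply/existsNP => tS'; move/negP: tS; apply; exact/mem_set.
      rewrite (bigD1 j)//= ifN ?mul0r ?mulr0//.
      by apply/negP => /set_mem.
    under [RHS]eq_bigr do rewrite entryE.
    rewrite (prod_insub MN (fun k k' =>
       varsigma Phi xi (u k) (tnth (insert2 tau p t) k') *
       Psi (a k) (tnth (insert2 tau p t) k'))).
    rewrite (prod_other_index _ tau_l tau_s).
    rewrite (tnth_insert2_fst _ _ tau_l) (tnth_insert2_snd _ _ tau_s).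
    rewrite mulrAC !mulrA; congr (_ * _ * _).
    apply: eq_bigr => j _; rewrite tnth_insert2_other ifT//.
    by apply/mem_set; exact: tS.
  under [RHS]eq_bigr do rewrite tensorA_entry.
  rewrite (prod_insub MN (fun k k' => tensor_entry p (u k) (a k) k')).
  rewrite (prod_other_index _ tau_l tau_s) /tensor_entry eqxx.
  have /negbTE-> : s != l by rewrite -val_eqE /= gtn_eqF.
  rewrite eqxx mulrAC !mulrA; congr (_ * _ * _).
  apply: eq_bigr => j _; have [/negbTE-> /negbTE->] := other_index_neq tau_l tau_s j.
  by [].
have := has_cintegralZ K (has_cintegral_sum (index_enum _) xpredT
  (fun u : 'S_N => has_cintegralZ ((-1) ^+ u)
     (has_cintegral_sum (index_enum _) xpredT
       (fun a : 'S_N => has_cintegralZ ((-1) ^+ a) (term_int u a))))).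
apply: eq_has_cintegral => // t; rewrite /term -/S; case: ifP => tS.
  by rewrite ordered_pdf_pseudo_det.
rewrite big1 ?mulr0// => u _; rewrite big1 ?mulr0// => a _; exact: mulr0.
Qed.

End tensor_integral.

(** * The joint density *)

Section joint_density.
Context {R : realType}.
Local Notation C := R[i].
Local Notation Re := (@complex.Re R).
Local Notation Im := (@complex.Im R).
Local Notation leb := (@lebesgue_measure R).

Lemma c_coefE M (l s : 'I_M) : c_coef R l s =
  real_complex R ((l`! * (s - l - 1)`! * (M - s - 1)`!)%N%:R)^-1.
Proof. by rewrite /c_coef -(rmorph_nat (real_complex R)) fmorphV. Qed.

(** Stated for tuples of length [m.+2], the form in which [insert2] rebuilds a
    tuple from two selected entries and the [m] others. *)
Lemma joint_pdf_pair d (Omega : measurableType d) (P : probability Omega R)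
    (alpha beta : \bar R) m N (Phi : 'I_m.+2 -> R -> C) (Psi : 'I_N -> R -> C)
    (xi : R -> C) (Psibar : 'I_N -> 'I_N -> C) (K : C) (l s : 'I_m.+2)
    (X : Omega -> m.+2.-tuple R) :
  (m.+2 <= N)%N ->
  has_pdf_on P (lebesgue_tuple R m.+2) X (ordered_region alpha beta)
    (ordered_pdf Phi Psi xi Psibar K) ->
  tensorA_well_defined alpha beta Phi Psi xi l s ->
  (l < s)%N ->
  has_pdf_on P (leb \x leb)%E (fun w => (tnth (X w) l, tnth (X w) s))
    (pair_region alpha beta)
    (fun p => c_coef R l s * K *
       pseudo_det (tensorA alpha beta Phi Psi xi Psibar l s p.1 p.2)).
Proof.
move=> MN [pdf_ge0 mpdf pdfP] wd ls.
set F := ordered_pdf _ _ _ _ _ in pdf_ge0 mpdf pdfP.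
have F_sym sigma x : F (permute sigma x) = F x by exact: ordered_pdf_permute.
(* By symmetry, what is known on the ordered region extends to the cube. *)
have F_ge0 x : cube alpha beta x -> 0 <= F x.
  move=> xc; have [sigma _ xs] := exists_sorting [set: 'I_m.+2]%SET x.
  rewrite -(F_sym sigma); apply: pdf_ge0; rewrite ordered_regionE.
  by split=> //; exact: cube_permute.
pose f x := Re (F x).
have f_ge0 x : cube alpha beta x -> 0 <= f x.
  by move/F_ge0; rewrite lecE => /andP[].
have mf : measurable_fun (@cube R alpha beta m.+2) f.
  apply: (measurable_fun_sorted (A := [set: 'I_m.+2]%SET)).
  - by move=> sigma x _; exact: cube_permute.
  - exact: measurable_cube.
  - by move=> sigma x _ _; rewrite /f F_sym.
  - by rewrite -ordered_regionE.
set D := pivoted_region alpha beta l s.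
have DC : D `<=` @cube R alpha beta m.+2 by move=> x [].
have mD : measurable D by exact: measurable_pivoted_region.
have mfD : measurable_fun D (EFin \o f).
  by apply/measurable_EFinP; apply: measurable_funS mf => //; exact: measurable_cube.
pose h := (EFin \o f) \_ D.
have mh : measurable_fun setT h by exact/(measurable_restrictT _ mD).
have h0 x : (0 <= h x)%E.
  by rewrite /h patchE; case: ifPn => // /set_mem/DC/f_ge0; rewrite lee_fin.
have l_neq_s : l != s by rewrite -val_eqE /= ltn_eqF.
(* The integral of a slice of [h] is computed by Fubini, which yields the tensor;
   integrating these slices by Tonelli yields the law of the pair. *)
have [tau [tau_l tau_s]] := perm_to_front l_neq_s.
pose T p := K * pseudo_det (tensorA alpha beta Phi Psi xi Psibar l s p.1 p.2).
pose slice (p : R * R) := (\int[lebesgue_tuple R m]_t h (insert2 tau p t))%E.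
have insertD p t : D (insert2 tau p t) <-> pair_region alpha beta p /\
    box (fun j => segment alpha beta l s p.1 p.2 (other_index tau j)) t.
  exact: pivoted_insert2.
have slice_pair p : pair_region alpha beta p -> slice p = (Re (T p))%:E /\ 0 <= T p.
  move=> pr; have [[_ intR] [_ intI]] :=
    has_cintegral_pseudo_det Psibar K MN ls tau_l tau_s wd pr.
  have sliceE : slice p = (Re (T p))%:E.
    rewrite -intR; apply: eq_integral => t _; rewrite /h patchE /=.
    case: ifPn => [/set_mem/insertD[_ tb]|tD]; first by rewrite mem_set.
    by rewrite ifN//; apply: contra tD => /set_mem tb; apply/mem_set/insertD.
  split=> //; rewrite lecE; apply/andP; split; last first.
    by rewrite -lee_fin -sliceE; apply: integral_ge0.
  apply/eqP; apply: EFin_inj; rewrite -intI; apply: integral0_eq => t _ /=.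
  case: ifPn => // /set_mem tb; rewrite ger0_Im//; apply: F_ge0; apply: DC.
  exact/insertD.
have slice_out p : ~ pair_region alpha beta p -> slice p = 0%E.
  move=> npr; apply: integral0_eq => t _; rewrite /h patchE ifN//.
  by apply/negP => /set_mem/insertD[].
have mslice : measurable_fun [set: measurableTypeR R * measurableTypeR R] slice.
  exact: measurable_integral_insert2.
have slice_ge0 p : (0 <= slice p)%E by exact: integral_ge0.
pose n := (l`! * (s - l - 1)`! * (m.+2 - s - 1)`!)%N.
have n_neq0 : n%:R != 0 :> R by rewrite pnatr_eq0 -lt0n !muln_gt0 !fact_gt0.
have densityE p : Re (c_coef R l s * K *
    pseudo_det (tensorA alpha beta Phi Psi xi Psibar l s p.1 p.2)) =
    n%:R^-1 * Re (T p).
  by rewrite -mulrA c_coefE complexReM /= mul0r subr0.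
split.
- move=> p /slice_pair[_ T0]; rewrite -mulrA mulr_ge0//.
  by rewrite /c_coef invr_ge0 ler0n.
- apply: (eq_measurable_fun (fun p => n%:R^-1 * fine (slice p))).
    by move=> p /set_mem/slice_pair[-> _]; rewrite densityE.
  apply: measurable_funTS; apply: measurable_funM => //.
  exact: (measurableT_comp (@fine_measurable R setT measurableT) mslice).
move=> A mA.
pose A' : set (m.+2.-tuple R) := [set x | A (tnth x l, tnth x s)].
have mA' : measurable A'.
  have mpair : measurable_fun setT (fun x : m.+2.-tuple R =>
      ((tnth x l : measurableTypeR R), (tnth x s : measurableTypeR R))).
    by apply/measurable_fun_pair; exact: measurable_tnth.
  by rewrite -[X in measurable X]setTI; exact: mpair.
have -> : (fun w => (tnth (X w) l, tnth (X w) s)) @^-1` A = X @^-1` A' by [].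
rewrite pdfP//.
have unfold := @ge0_integral_pivoted _ alpha beta _ _ _ ls A' (EFin \o f) mA'.
have {}unfold : (\int[lebesgue_tuple R m.+2]_(x in A' `&` D) (f x)%:E =
    n%:R%:E * \int[lebesgue_tuple R m.+2]_(x in A' `&` ordered_region alpha beta)
      (f x)%:E)%E.
  apply: unfold => //.
  - by move=> sigma x sl ss; rewrite /A' /= !tnth_permute sl ss.
  - by move=> sigma x; rewrite /f /= F_sym.
  - by move=> x /DC/f_ge0; rewrite lee_fin.
have slices : (\int[lebesgue_tuple R m.+2]_(x in A' `&` D) (f x)%:E =
    \int[leb \x leb]_(p in A) slice p)%E.
  rewrite integral_mkcond [RHS]integral_mkcond.
  rewrite (ge0_integral_insert2 tau); first last.
  - by move=> x; apply: erestrict_ge0 => {}x [_ /DC/f_ge0]; rewrite lee_fin.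
  - apply/(measurable_restrictT _ (measurableI _ _ mA' mD)).
    exact: measurable_funS mfD.
  apply: eq_integral => p _; rewrite [RHS]patchE; case: ifPn => pA.
    apply: eq_integral => t _; rewrite /h !patchE in_setI [_ \in A']mem_set//.
    rewrite /A' /= (tnth_insert2_fst _ _ tau_l) (tnth_insert2_snd _ _ tau_s).
    by rewrite -surjective_pairing; exact/set_mem.
  apply: integral0_eq => t _; rewrite patchE ifN//; apply: contra pA.
  move=> /set_mem[+ _]; rewrite /A' /=.
  rewrite (tnth_insert2_fst _ _ tau_l) (tnth_insert2_snd _ _ tau_s).
  by rewrite -surjective_pairing => /mem_set.
transitivity (n%:R^-1%:E * \int[leb \x leb]_(p in A) slice p)%E.
  by rewrite -slices unfold muleA -EFinM mulVf// mul1e.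
rewrite -ge0_integralZl//; last exact: measurable_funTS.
rewrite integral_mkcond [RHS]integral_mkcond; apply: eq_integral => p _.
rewrite !patchE in_setI; case: (p \in A) => //=; case: ifPn => [/set_mem pr|pr].
  by rewrite densityE (slice_pair p pr).1.
by rewrite slice_out ?mule0// => pr'; move/negP: pr; apply; exact/mem_set.
Qed.

End joint_density.

Theorem lemma3p2 (R : realType) (d : measure_display)
  (Omega : measurableType d) (P : probability Omega R)
  (alpha beta : \bar R) (M N : nat)
  (Phi : 'I_M -> R -> R[i]) (Psi : 'I_N -> R -> R[i]) (xi : R -> R[i])
  (Psibar : 'I_N -> 'I_N -> R[i]) (K : R[i])
  (lambda : 'I_M -> {RV P >-> R}) (l s : 'I_M) :
  (1 <= M <= N)%N ->
  (alpha < beta)%E ->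
  {ae P, forall w,
    ordered_region alpha beta [tuple lambda i w | i < M]} ->
  has_pdf_on P (lebesgue_tuple R M)
    (fun w => [tuple lambda i w | i < M])
    (ordered_region alpha beta)
    (ordered_pdf Phi Psi xi Psibar K) ->
  tensorA_well_defined alpha beta Phi Psi xi l s ->
  (l < s)%N ->
  has_pdf_on P (lebesgue_measure \x lebesgue_measure)%E
    (fun w => (lambda l w, lambda s w))
    (pair_region alpha beta)
    (fun p => c_coef R l s * K *
       pseudo_det (tensorA alpha beta Phi Psi xi Psibar l s p.1 p.2)).
Proof.
move=> /andP[_ MN] _ _ pdf wd ls.
have -> : (fun w => (lambda l w, lambda s w)) =
    (fun w => let x := [tuple lambda i w | i < M] in (tnth x l, tnth x s)).
  by apply/funext => w /=; rewrite !tnth_mktuple.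
case: M Phi lambda l s MN pdf wd ls => [|[|m]] Phi lambda l s MN pdf wd ls.
- by case: l ls {wd}.
- by move: ls; rewrite (ord1 s).
- exact: joint_pdf_pair MN pdf wd ls.
Qed.
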